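(* Let $\Gamma$ be a countable group and let $\bm{b}=\Gamma\curvearrowright^b(Y,\nu)$ be a measure preserving action of $\Gamma$. Let $\bm{\iota}$ denote the identity (trivial) action of $\Gamma$ on a standard non-atomic probability space. Then $\overline{E(\bm{\iota}\times\bm{b},K)}=\overline{\mathrm{co}}\,E(\bm{b},K)$ for every compact Polish space $K$. In particular, for any measure preserving action $\bm{a}=\Gamma\curvearrowright^a(X,\mu)$ we have $\bm{a}\prec\bm{\iota}\times\bm{b}$ if and only if $E(\bm{a},K)\subseteq\overline{\mathrm{co}}\,E(\bm{b},K)$ for every compact Polish space $K$.
   Context: A measure preserving action $\bm{a}=\Gamma\curvearrowright^a(X,\mu)$ of a countable group $\Gamma$ is a Borel action $a$ of $\Gamma$ on a standard Borel space $X$ preserving a Borel probability measure $\mu$ on $X$; write $\gamma^a x$ for the action of $\gamma$ on $x$. Weak containment: $\bm{a}\prec\bm{b}$ (for $\bm{a}$ on $(X,\mu)$, $\bm{b}$ on $(Y,\nu)$) means that for every finite Borel partition $A_0,\dots,A_{k-1}$ of $X$, every finite $F\subseteq\Gamma$, and every $\epsilon>0$ there is a Borel partition $B_0,\dots,B_{k-1}$ of $Y$ with $|\mu(\gamma^aA_i\cap A_j)-\nu(\gamma^bB_i\cap B_j)|<\epsilon$ for all $\gamma\in F$ and $i,j<k$. For a compact Polish space $K$, $K^\Gamma$ carries the product topology and the shift action $(\gamma^s f)(\delta)=f(\gamma^{-1}\delta)$; $M_s(K^\Gamma)$ is the convex set of shift-invariant Borel probability measures on $K^\Gamma$ with the weak$^*$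 topology (a compact metrizable space). For a Borel map $\phi:X\to K$ let $\Phi^{\phi,a}:X\to K^\Gamma$, $\Phi^{\phi,a}(x)(\gamma)=\phi((\gamma^{-1})^a x)$, and let $E(\bm{a},K)=\{(\Phi^{\phi,a})_*\mu : \phi:X\to K \text{ Borel}\}\subseteq M_s(K^\Gamma)$. Closures are taken in $M_s(K^\Gamma)$ and $\overline{\mathrm{co}}$ denotes the closed convex hull. $\bm{\iota}\times\bm{b}$ is the product (diagonal) action with the product measure. *)

(* Defs.v *)
From HB Require Import structures.
From mathcomp Require Import all_boot all_order all_algebra.
From mathcomp Require Import all_classical all_reals all_analysis.

Set Implicit Arguments.
Unset Strict Implicit.
Unset Printing Implicit Defensive.

Import Order.TTheory GRing.Theory Num.Theory.
Import numFieldNormedType.Exports.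

Local Open Scope classical_set_scope.
Local Open Scope ring_scope.

Definition separable (T : topologicalType) :=
  exists2 D : set T, countable D & dense D.

Definition completely_metrizable (R : realType) (T : topologicalType) :=
  exists (M : metricType R) (f : T -> M) (g : M -> T),
    [/\ cancel f g, cancel g f, continuous f, continuous g &
        forall F : set_system M, ProperFilter F -> cauchy F -> exists x : M, F --> x].

Definition polish (R : realType) (T : topologicalType) :=
  separable T /\ completely_metrizable R T.

Definition standard_borel (R : realType) d (X : measurableType d) :=
  exists (P : topologicalType) (f : X -> P),
    [/\ polish R P, bijective f &
        @measurable d X = [set f @^-1` B | B in <<s @open P>>]].

Definition borel (T : ptopologicalType) := g_sigma_algebraType (@open T).

HB.instance Definition _ (T : ptopologicalType) :=
  Measurable.copy (borel T) (g_sigma_algebraType (@open T)).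

Definition nonatomic (R : realType) d (X : measurableType d)
    (mu : probability X R) :=
  forall A : set X, measurable A -> (0 < mu A)%E ->
    exists B : set X,
      [/\ measurable B, B `<=` A, (0 < mu B)%E & (mu B < mu A)%E].

Section actions.
Context (R : realType) (G : groupType).

(* Joint measurability on G * X is the same as measurability of each [a g],
   since G is countable and discrete. *)
Record mp_action d (X : measurableType d) (mu : probability X R)
    (a : G -> X -> X) : Prop := MpAction {
  mp_standard : standard_borel R X ;
  mp_act1 : forall x, a 1%g x = x ;
  mp_actM : forall g h x, a (g * h)%g x = a g (a h x) ;
  mp_measurable : forall g, measurable_fun [set: X] (a g) ;
  mp_preserving : forall g (A : set X), measurable A ->
    mu (a g @^-1` A) = mu A }.

Definition trivial_action (Z : Type) (g : G) (z : Z) : Z := z.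

Definition diag_action (X Y : Type) (a : G -> X -> X) (b : G -> Y -> Y)
    (g : G) (p : X * Y) : X * Y := (a g p.1, b g p.2).

(* Unlike in [partition], parts may be empty. *)
Definition borel_partition d (X : measurableType d) k (A : 'I_k -> set X) :=
  [/\ forall i, measurable (A i), trivIset [set: 'I_k] A &
      \bigcup_i A i = [set: X]].

Definition weakly_contained dX (X : measurableType dX) (mu : probability X R)
    (a : G -> X -> X) dY (Y : measurableType dY) (nu : probability Y R)
    (b : G -> Y -> Y) :=
  forall k (A : 'I_k -> set X) (F : set G) (eps : R),
    borel_partition A -> finite_set F -> 0 < eps ->
    exists2 B : 'I_k -> set Y, borel_partition B &
      forall g i j, F g ->
        (`|mu (a g @` A i `&` A j) - nu (b g @` B i `&` B j)| < eps%:E)%E.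

End actions.

(* [wprob R T] is only used for compact T, where every continuous function is
   bounded. Elements of [probability] also carry values on non-Borel sets; the
   topology does not see them, and measures are compared on Borel sets only. *)
Section weak_star.
Context (R : realType) (T : ptopologicalType).

Definition integrals (m : probability (borel T) R) :
    prod_topology (fun _ : continuousType T R => R) :=
  fun f => \int[m]_x f x.

Definition wprob := initial_topology integrals.

HB.instance Definition _ := Topological.copy wprob (initial_topology integrals).

End weak_star.

Definition power (I : Type) (K : topologicalType) :=
  prod_topology (fun _ : I => K).

HB.instance Definition _ (I : Type) (K : topologicalType) :=
  Topological.on (power I K).
HB.instance Definition _ (I : Type) (K : ptopologicalType) :=
  isPointed.Build (power I K) (fun=> point).

Section invariant_measures.
Context (R : realType) (G : groupType) (K : ptopologicalType).

Local Notation power := (power G K).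

Definition shift (g : G) (f : power) : power := fun h => f (g^-1 * h)%g.

Definition shift_invariant : set (wprob R power) :=
  [set m : probability (borel power) R | forall g (A : set (borel power)),
    measurable A -> m (shift g @^-1` A) = m A].

Definition Ms : topologicalType := set_type shift_invariant.

Definition Ms_prob (m : Ms) : probability (borel power) R := set_val m.

Definition orbit_map d (X : measurableType d) (a : G -> X -> X) (phi : X -> K) :
    X -> power :=
  fun x g => phi (a (g^-1)%g x).

Definition E_set d (X : measurableType d) (mu : probability X R)
    (a : G -> X -> X) : set Ms :=
  [set m : Ms | exists2 phi : X -> K,
    measurable_fun [set: X] (phi : X -> borel K) &
    forall A : set (borel power), measurable A ->
      Ms_prob m A =
      pushforward mu (orbit_map a phi : X -> borel power) A].

Definition convex_hull (S : set Ms) : set Ms :=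
  [set m : Ms | exists n (t : 'I_n -> R) (e : 'I_n -> Ms),
    [/\ forall i, 0 <= t i, \sum_i t i = 1, forall i, S (e i) &
        forall A : set (borel power), measurable A ->
          Ms_prob m A = (\sum_i (t i)%:E * Ms_prob (e i) A)%E]].

Definition closed_convex_hull (S : set Ms) : set Ms := closure (convex_hull S).

End invariant_measures.

Arguments E_set {R G} K {d X} mu a.

(* Main.v *)
(* Slicing [phi : Z * Y -> K] at each [z] writes the measure of [phi] under
   [iota x b] as an average over [z] of measures in [E(b, K)]; on finitely many
   continuous test functions such an average is approximated by a finite convex
   combination.  Conversely a nonatomic space splits into pieces of prescribed
   masses, so convex combinations of elements of [E(b, K)] lie in
   [E(iota x b, K)].  The second assertion then reduces to: [a] is weakly
   contained in [c] iff [E(a, K)] is in the closure of [E(c, K)] for all [K].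
   For the direct implication, weak containment is applied to the partition
   refined by finitely many translates; for the converse, take [K] finite
   discrete and test on indicators of pairs of coordinates. *)
Require Import Defs.
From HB Require Import structures.
From mathcomp Require Import all_boot all_order all_algebra.
From mathcomp Require Import finmap.
From mathcomp Require Import all_classical all_reals all_analysis.
From mathcomp Require Import measurable_realfun.
From mathcomp Require Import lra.

Set Implicit Arguments.
Unset Strict Implicit.
Unset Printing Implicit Defensive.

Import Order.TTheory GRing.Theory Num.Theory.
Import numFieldNormedType.Exports.

Local Open Scope classical_set_scope.
Local Open Scope ring_scope.

(** * Product topologies and Polish spaces *)

Lemma nbhs_prod_box (I : Type) (T : I -> topologicalType)
    (x : prod_topology T) (A : set (prod_topology T)) :
  nbhs x A -> exists (D : set I) (V : forall i, set (T i)),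
    [/\ finite_set D, forall i, open (V i), forall i, V i (x i) &
        forall y : prod_topology T, (forall i, D i -> V i (y i)) -> A y].
Proof.
(* The sets containing a box form a filter. The product topology is a supremum, so convergence of
   this filter to [x] is checked one coordinate at a time. *)
pose F : set_system (prod_topology T) := [set B | exists (D : set I) (V : forall i, set (T i)),
    [/\ finite_set D, forall i, open (V i), forall i, V i (x i) &
        forall y : prod_topology T, (forall i, D i -> V i (y i)) -> B y]].
have FF : Filter F.
  split.
  - exists set0, (fun=> setT); split => // i; exact: openT.
  - move=> P Q [D [V [fD oV Vx VP]]] [D' [V' [fD' oV' Vx' VP']]].
    exists (D `|` D'), (fun i => V i `&` V' i); split => //.
    + by rewrite finite_setU.
    + by move=> i; exact: openI.
    + by move=> y yV; split; [apply: VP|apply: VP'] => i Di;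
        [have [] := yV i (or_introl Di)|have [] := yV i (or_intror Di)].
  - move=> P Q PQ [D [V [fD oV Vx VP]]]; exists D, V; split => // y /VP; exact: PQ.
suff : F --> x by apply.
apply/cvg_sup => i B /= [_ [[U oU <-] /= Ux UB]].
(* Only coordinate [i] is constrained: a proof of [j = i] transports a point of [T j] to [T i], and
   for other [j] the condition is vacuous. *)
exists [set i], (fun j => [set z : T j | forall e : j = i, U (ecast k (T k) e z)]).
split => //.
- move=> j; have [e|ne] := pselect (j = i).
    destruct e; rewrite [X in open X](_ : _ = U)//.
    apply/seteqP; split=> z /=; first by move=> /(_ erefl).
    by move=> Uz e; rewrite (Prop_irrelevance e erefl).
  rewrite [X in open X](_ : _ = setT); first exact: openT.
  by apply/seteqP; split=> z //= _ e; case: ne.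
- by move=> j /= e; destruct e.
- by move=> y /(_ i erefl) /(_ erefl) /UB.
Qed.

Lemma prod_proj_continuous (I : Type) (T : I -> topologicalType) (i : I) :
  continuous (fun f : prod_topology T => f i).
Proof. exact: (@proj_continuous {classic I} T i). Qed.

(** The balls of radius [1/(n+1)] about the points of a countable dense set form a base, once pulled
    back along the homeomorphism [f]. *)
Lemma polish_second_countable (R : realType) (T : topologicalType) :
  polish R T -> @second_countable T.
Proof.
case=> [[D cD dD] [M [f [g [fK gK cf cg _]]]]].
pose U (p : T * nat) : set T := f @^-1` (ball (f p.1) p.2.+1%:R^-1)°.
have npos n : (0:R) < n.+1%:R^-1 by [].
exists (U @` (D `*` setT)).
  apply: (sub_countable (card_image_le _ _)).
  exact: (countableX cD (@countableP _ [set: nat])).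
split.
  move=> _ [p _ <-]; rewrite /U.
  by apply: open_comp; [move=> ? _; exact: cf|exact: open_interior].
move=> x V /= Vx.
have : nbhs (f x) (g @^-1` V) by apply: cg; rewrite fK.
move=> /nbhs_ballP[_/posnumP[e] eV].
(* With [1/(N+1) < e/2], a dense point [d] within half of [1/(N+1)] of [x] has a basic ball that is
   a neighbourhood of [x] and stays in the [e]-ball of [x]. *)
have [//|N] := @ltr_add_invr R 0 (e%:num/2) _; rewrite add0r => Ne.
have N2 : (0 : R) < N.+1%:R^-1 / 2 by rewrite divr_gt0.
have : (f @^-1` (ball (f x) (N.+1%:R^-1 / 2))° `&` D) !=set0.
  apply: dD; last first.
    by apply: open_comp; [move=> ? _; exact: cf|exact: open_interior].
  by exists x; exact: (nbhsx_ballx _ _ N2).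
case=> d [/= /interior_subset dx Dd].
have dx' : ball (f d) N.+1%:R^-1 (f x).
  by apply: le_ball (ball_sym dx); rewrite ler_pdivrMr// ler_peMr// ler1n.
exists (U (d, N)).
  split; first by exists (d, N).
  apply: (filterS _ (nbhsx_ballx (f x) _ N2)) => z xz /=.
  by rewrite [N.+1%:R^-1]splitr; apply: ball_triangle xz; exact: ball_sym.
move=> z /= /interior_subset /= dz; rewrite -[z]fK; apply: eV.
rewrite [e%:num]splitr; apply: (@ball_triangle _ _ (f d)).
  by apply: (le_ball (ltW Ne)); exact: ball_sym.
by apply: (le_ball (ltW Ne)).
Qed.

Lemma countable_bigcup_measurable d (T : measurableType d) (I : Type)
    (D : set I) (F : I -> set T) : countable D ->
  (forall i, D i -> measurable (F i)) -> measurable (\bigcup_(i in D) F i).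
Proof.
move=> cD mF; rewrite bigcup_set_type.
apply: countable_bigcupT_measurable => [|i].
  by rewrite (eq_countable (card_setT _)).
exact/mF/set_valP.
Qed.

(** * Measurability of maps into countable powers *)

Section power_measurability.
Context d (X : measurableType d) (I : Type) (K : ptopologicalType).

(* Second countability makes the Borel sets of the power be generated by
   countably many cylinders. *)
Lemma measurable_to_power (h : X -> power I K) :
  countable [set: I] -> @second_countable K ->
  (forall i, measurable_fun [set: X] (fun x => h x i : borel K)) ->
  measurable_fun [set: X] (h : X -> borel (power I K)).
Proof.
move=> cI [B cB [oB bB]] mh.
pose D : set (set (power I K)) :=
  [set (fun p : power I K => p iC.1) @^-1` iC.2 | iC in [set: I] `*` B].
pose W := finI_from D id.
have cW : countable W.
  apply: finI_from_countable; apply: (sub_countable (card_image_le _ _)).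
  exact: countableX.
apply: (@measurability _ _ _ (borel (power I K)) _ _ open) => // _ [U oU <-].
rewrite setTI.
(* Each point of the open set [U] in the range of [h] lies in a box inside [U], which shrinks to one
   of the countably many members of [W]. *)
have -> : h @^-1` U = \bigcup_(w in W `&` [set w | w `<=` U]) h @^-1` w.
  apply/seteqP; split => [x /= Ux|x [w [_ wU] /wU]//].
  have /nbhs_prod_box[J [V [fJ oV Vx VU]]] : nbhs (h x) U by exact: open_nbhs_nbhs.
  have /choice[C VC] i : exists C : set K, [/\ B C, C (h x i) & C `<=` V i].
    have : nbhs (h x i) (V i) by apply: open_nbhs_nbhs; split.
    by move=> /bB[C [BC Cx] CV]; exists C.
  have /finite_fsetP[S JS] : finite_set
      ((fun i => (fun p : power I K => p i) @^-1` C i) @` J).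
    exact: finite_image.
  have HS w : w \in S <-> exists2 i, J i & (fun p : power I K => p i) @^-1` C i = w.
    by have /seteqP[P Q] := JS; split => [/Q//|/P].
  exists (\bigcap_(w in [set` S]) w); last first.
    by move=> _ /= /HS[i _ <-]; have [] := VC i.
  split.
    exists S => // w /HS[i _ <-]; rewrite inE; exists (i, C i) => //.
    by split => //; have [] := VC i.
  move=> p wp; apply: VU => i Ji; have [_ _] := VC i; apply.
  by apply: (wp ((fun p : power I K => p i) @^-1` C i)); apply/HS; exists i.
apply: countable_bigcup_measurable.
  by apply: sub_countable cW; apply: subset_card_le; apply: subIsetl.
move=> w [[S SD <-] _]; rewrite preimage_bigcap.
apply: fin_bigcap_measurable; first exact: finite_fset.
move=> v /SD; rewrite inE => -[[i C] /= [_ BC] <-].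
have := mh i measurableT C; rewrite setTI; apply.
by apply: sub_sigma_algebra; exact: oB.
Qed.

End power_measurability.

Lemma continuous_borel_measurable (R : realType) (T : ptopologicalType) (f : T -> R) :
  continuous f -> measurable_fun [set: borel T] (f : borel T -> R).
Proof.
move=> cf; apply: (measurability _ (measurable_realfun.RGenOpens.measurableE R)).
move=> _ [_ [a [b ->]] <-]; rewrite setTI; apply: sub_sigma_algebra.
apply: open_comp => // ? _; exact: cf.
Qed.

(** * The weak* topology on invariant measures *)

Section Ms_topology.
Context (R : realType) (G : groupType) (K : ptopologicalType).
Local Notation pow := (power G K).
Local Notation C := (continuousType pow R).

Definition expect (m : Ms R G K) (f : C) : R := \int[Ms_prob m]_p f p.

Lemma expect_continuous (f : C) : continuous (expect ^~ f).
Proof.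
move=> m.
have c1 : {for m, continuous (set_val : Ms R G K -> wprob R pow)}.
  exact: (@initial_continuous _ _ (set_val : Ms R G K -> wprob R pow)).
have c2 : {for set_val m, continuous (@integrals R pow : wprob R pow -> _)}.
  exact: (@initial_continuous _ _ (@integrals R pow)).
have c3 := @prod_proj_continuous C (fun=> R) f (integrals (set_val m)).
exact: (continuous_comp (continuous_comp c1 c2) c3).
Qed.

(** The topology is initial for the integrals of continuous functions, so a basic neighbourhood of
    [m] restricts finitely many integrals. Membership in a closure thus becomes approximation on
    finite sets of test functions. *)
Lemma closure_MsP (S : set (Ms R G K)) (m : Ms R G K) :
  closure S m <-> forall (D : set C) (e : R), finite_set D -> 0 < e ->
    exists2 m', S m' & forall f, D f -> `|expect m f - expect m' f| < e.
Proof.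
split => [clS D e fD e0|HS A].
  have /clS[m' [Sm' m'D]] : nbhs m
      (\bigcap_(f in D) [set m' | `|expect m f - expect m' f| < e]).
    have [s Ds] := (@finite_fsetP _ D).1 fD; rewrite Ds.
    apply: filter_bigI => f _.
    exact: (@expect_continuous f m (ball (expect m f) e) (nbhsx_ballx _ _ e0)).
  by exists m'.
move=> [_ [[_ [U oU <-] <-] /= Um UA]].
have /nbhs_prod_box[D [V [fD oV Vm VU]]] :
    nbhs (integrals (set_val m : wprob R pow)) U by exact: open_nbhs_nbhs.
have /choice[e He] f : exists e : R, 0 < e /\
    ball (expect m f) e `<=` V f.
  have /nbhs_ballP[e /= e0 eV] : nbhs (expect m f) (V f).
    by apply: open_nbhs_nbhs; split => //; exact: Vm.
  by exists e.
have [s Ds] := (@finite_fsetP _ D).1 fD.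
have [e0 e00 e0D] : exists2 e0 : R, 0 < e0 & forall f, D f -> e0 <= e f.
  exists (\big[Num.min/1]_(f <- s) e f).
    by apply: lt_bigmin => // f _; have [] := He f.
  move=> f; rewrite Ds => fs; exact: (@bigmin_inf_seq _ _ _ _ _ f).
have [m' Sm' m'D] := HS D e0 fD e00.
exists m'; split => //; apply: UA => /=; apply: VU => f Df.
have [_] := He f; apply; apply: lt_le_trans (e0D _ Df); exact: m'D.
Qed.

End Ms_topology.

(* [mp_action] without the standardness of the space, so that products need not
   be shown to be standard Borel. *)
Record invariant_action (R : realType) (G : groupType) d (X : measurableType d)
    (mu : probability X R) (a : G -> X -> X) : Prop := InvariantAction {
  inv_act1 : forall x, a 1%g x = x ;
  inv_actM : forall g h x, a (g * h)%g x = a g (a h x) ;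
  inv_measurable : forall g, measurable_fun [set: X] (a g) ;
  inv_preserving : forall g (A : set X), measurable A ->
    mu (a g @^-1` A) = mu A }.

Lemma mp_invariant_action (R : realType) (G : groupType) d (X : measurableType d)
    (mu : probability X R) (a : G -> X -> X) :
  mp_action mu a -> invariant_action mu a.
Proof. by case. Qed.

(** * Compactness, bounded functions and image laws *)

Lemma power_compact (I : Type) (K : topologicalType) :
  compact [set: K] -> compact [set: power I K].
Proof.
move=> cK; have := @tychonoff {classic I} (fun=> K) (fun=> setT) (fun=> cK).
by congr compact; apply/seteqP; split.
Qed.

Lemma continuous_compact_bounded (R : realType) (T : topologicalType) (f : T -> R) :
  compact [set: T] -> continuous f ->
  exists2 M : R, 0 <= M & forall x, `|f x| <= M.
Proof.
move=> cT cf.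
have : compact (f @` setT).
  by apply: continuous_compact => //; apply: continuous_subspaceT.
move=> /compact_bounded[M [_ HM]]; exists (`|M| + 1); first by rewrite addr_ge0.
move=> x; apply: HM; last by exists x.
by rewrite ltr_pwDr// ler_norm.
Qed.

Lemma compact_uniform_bound (R : realType) (T : topologicalType)
    (D : set (continuousType T R)) : compact [set: T] -> finite_set D ->
  exists2 M : R, 0 <= M & forall f, D f -> forall x, `|f x| <= M.
Proof.
move=> cT fD; have [s Ds] := (@finite_seqP _ D).1 fD.
have /choice[Mf Hf] (f : continuousType T R) : exists M : R, forall x, `|f x| <= M.
  by have [M _ fM] := continuous_compact_bounded cT (@cts_fun _ _ f); exists M.
exists (\sum_(f <- s) `|Mf f|); first exact: sumr_ge0.
move=> f; rewrite Ds => fs x.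
apply: (le_trans (Hf f x)); apply: (le_trans (ler_norm _)).
by rewrite (big_rem f)//= lerDl sumr_ge0.
Qed.

Lemma bounded_integrable (R : realType) d (X : measurableType d)
    (mu : probability X R) (u : X -> R) (M : R) :
  measurable_fun [set: X] u -> (forall x, `|u x| <= M) ->
  mu.-integrable [set: X] (EFin \o u).
Proof.
move=> mu_ uM; apply: measurable_bounded_integrable => //.
  exact: le_lt_trans (probability_le1 mu measurableT) (ltry _).
exists M; split; first exact: num_real.
by move=> N MN x _ /=; rewrite (le_trans (uM _))// ltW.
Qed.

(** A measure in [E_set] is prescribed on Borel sets only, so this change of variables assumes the
    image law on measurable sets instead of an equality of measures. *)
Lemma Rintegral_law (R : realType) d d' (X : measurableType d)
    (Y : measurableType d') (mu : probability X R) (m : probability Y R)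
    (h : X -> Y) (f : Y -> R) :
  measurable_fun [set: X] h ->
  (forall A, measurable A -> m A = mu (h @^-1` A)) ->
  measurable_fun [set: Y] f -> mu.-integrable [set: X] (EFin \o (f \o h)) ->
  \int[m]_y f y = \int[mu]_x f (h x).
Proof.
move=> mh mE mf intf; rewrite /Rintegral; congr fine.
pose hm := isMeasurableFun.Build _ _ X Y h mh.
pose H : {mfun X >-> Y} := HB.pack h hm.
rewrite (eq_measure_integral (distribution mu H)); last by move=> A mA _; exact: mE.
by rewrite integral_distribution//; exact/measurable_EFinP.
Qed.

(** * Orbit maps and their laws *)

Section orbit_measures.
Context (R : realType) (G : groupType) (K : ptopologicalType).
Context (cG : countable [set: G]) (sK : @second_countable K).
Local Notation pow := (power G K).
Context d (X : measurableType d) (mu : probability X R) (a : G -> X -> X).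
Context (ha : invariant_action mu a).
Context (phi : X -> K) (mphi : measurable_fun [set: X] (phi : X -> borel K)).

Lemma orbit_map_act g x : orbit_map a phi (a g x) = Defs.shift g (orbit_map a phi x).
Proof.
apply/funext => k; rewrite /Defs.shift /orbit_map.
by rewrite invgM invgK (inv_actM ha).
Qed.

Lemma measurable_orbit_map : measurable_fun [set: X] (orbit_map a phi : X -> borel pow).
Proof.
apply: measurable_to_power => // g.
exact: (measurableT_comp mphi (inv_measurable ha _)).
Qed.

(** The orbit map intertwines the action with the shift, so invariance of [mu] passes to its law. *)
Lemma orbit_Ms : exists m : Ms R G K, forall A : set (borel pow), measurable A ->
  Ms_prob m A = mu (orbit_map a phi @^-1` A).
Proof.
pose h : X -> borel pow := orbit_map a phi.
pose hm := isMeasurableFun.Build _ _ X (borel pow) h measurable_orbit_map.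
pose H : {mfun X >-> borel pow} := HB.pack h hm.
pose P : probability (borel pow) R := distribution mu H.
have PE (A : set (borel pow)) : P A = mu (orbit_map a phi @^-1` A) by [].
have sP : @shift_invariant R G K P.
  move=> g A mA; rewrite !PE.
  have <- : mu (a g @^-1` (orbit_map a phi @^-1` A)) = mu (orbit_map a phi @^-1` A).
    apply: (inv_preserving ha); rewrite -[_ @^-1` A]setTI.
    exact: measurable_orbit_map.
  suff -> : a g @^-1` (orbit_map a phi @^-1` A) =
    orbit_map a phi @^-1` (Defs.shift g @^-1` A) by [].
  apply/seteqP; split => x /=; rewrite orbit_map_act//.
by exists (SigSub (mem_set sP)).
Qed.

Lemma measurable_orbit_comp (f : continuousType pow R) :
  measurable_fun [set: X] (fun x => f (orbit_map a phi x)).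
Proof.
have cf := @cts_fun _ _ f.
exact: (measurableT_comp (continuous_borel_measurable cf) measurable_orbit_map).
Qed.

Lemma integrable_orbit_comp (cK : compact [set: K]) (f : continuousType pow R) :
  mu.-integrable [set: X] (EFin \o (fun x => f (orbit_map a phi x))).
Proof.
have [M M0 fM] := continuous_compact_bounded (power_compact cK) (@cts_fun _ _ f).
by apply: (@bounded_integrable _ _ _ _ _ M) => //; exact: measurable_orbit_comp.
Qed.

Lemma expect_orbit (cK : compact [set: K]) (m : Ms R G K)
    (f : continuousType pow R) :
  (forall A : set (borel pow), measurable A ->
    Ms_prob m A = mu (orbit_map a phi @^-1` A)) ->
  expect m f = \int[mu]_x f (orbit_map a phi x).
Proof.
move=> mE; rewrite /expect.
apply: (Rintegral_law measurable_orbit_map mE).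
  exact: (continuous_borel_measurable (@cts_fun _ _ f)).
exact: integrable_orbit_comp.
Qed.

End orbit_measures.

(** * Products with a trivial action *)

Section product.
Context (R : realType) (G : groupType) dY (Y : measurableType dY)
  (nu : probability Y R) dZ (Z : measurableType dZ) (lam : probability Z R).

Lemma trivial_diag_invariant (b : G -> Y -> Y) : invariant_action nu b ->
  invariant_action (lam \x nu)%E (diag_action (@trivial_action G Z) b).
Proof.
move=> hb.
have mdiag g : measurable_fun [set: Z * Y] (diag_action (@trivial_action G Z) b g).
  apply/measurable_fun_pairP; split => /=; first exact: measurable_fst.
  exact: (measurableT_comp (inv_measurable hb g) measurable_snd).
split => //.
- by move=> [z y]; rewrite /diag_action/= (inv_act1 hb).
- by move=> g h [z y]; rewrite /diag_action/= (inv_actM hb).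
(* The first coordinate is fixed, so each section is moved by [b g] alone and keeps its
   [nu]-measure; integrating over [z] gives invariance. *)
- move=> g A mA; rewrite /product_measure1; apply: eq_integral => z _ /=.
  rewrite -[RHS](inv_preserving hb g); last exact: measurable_xsection.
  suff -> : xsection (diag_action (@trivial_action G Z) b g @^-1` A) z =
    b g @^-1` xsection A z by [].
  by apply/seteqP; split => y /=; rewrite /xsection/= !inE.
Qed.

Section mixture.
Context n (tau : Z -> 'I_n) (mtau : forall i, measurable (tau @^-1` [set i])).
Context (B : 'I_n -> set Y) (mB : forall i, measurable (B i)).

Let mixtureE : [set zy | B (tau zy.1) zy.2] =
  \big[setU/set0]_(i < n) (tau @^-1` [set i] `*` B i).
Proof.
rewrite -bigcup_seq; apply/seteqP; split => [[z y] /= Bzy|[z y] [i _ [/= <-]]//].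
by exists (tau z) => //=; rewrite mem_index_enum.
Qed.

Lemma measurable_mixture : measurable [set zy : Z * Y | B (tau zy.1) zy.2].
Proof.
by rewrite mixtureE; apply: bigsetU_measurable => i _; exact: measurableX.
Qed.

(** Over the cell of [Z] labelled [i] the set is a rectangle with fibre [B i]. This computes the law
    of a map on the product that follows a different map on [Y] over each cell. *)
Lemma mixture_measure : (lam \x nu)%E [set zy | B (tau zy.1) zy.2] =
  (\sum_(i < n) lam (tau @^-1` [set i]) * nu (B i))%E.
Proof.
rewrite mixtureE measure_bigsetU_ord//.
- by apply: eq_bigr => i _; rewrite -product_measure1E.
- by move=> i; exact: measurableX.
- apply/trivIsetP => i j _ _ /eqP ij; apply/seteqP; split => // -[z y] [] /=.
  by move=> [ti _] [tj _]; apply: ij; rewrite -ti.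
Qed.

End mixture.
End product.

(** * Splitting nonatomic spaces *)

Section nonatomic.
Context (R : realType) d (Z : measurableType d) (lam : probability Z R).
Context (naZ : nonatomic lam).
Local Notation p A := (fine (lam A)).

Let lamE A : measurable A -> lam A = (p A)%:E.
Proof. by move=> mA; rewrite fineK// fin_num_measure. Qed.

Let p_le A B : measurable A -> measurable B -> A `<=` B -> p A <= p B.
Proof.
by move=> mA mB AB; rewrite -lee_fin -!lamE//; apply: le_measure; rewrite ?inE.
Qed.

Let p_setD A B : measurable A -> measurable B -> B `<=` A ->
  p (A `\` B) = p A - p B.
Proof.
move=> mA mB BA; apply: EFin_inj.
rewrite EFinB -!lamE//; last exact: measurableD.
rewrite -{2}(setIidr BA); apply: measureD => //.
exact: le_lt_trans (probability_le1 lam mA) (ltry _).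
Qed.

Let p_setU A B : measurable A -> measurable B -> A `&` B = set0 ->
  p (A `|` B) = p A + p B.
Proof.
move=> mA mB AB; apply: EFin_inj.
by rewrite EFinD -!lamE//; [exact: measureU|exact: measurableU].
Qed.

(** A set of positive mass splits into two parts of positive mass, one of which has at most half;
    halving repeatedly goes below [e]. *)
Lemma nonatomic_small (A : set Z) (e : R) : measurable A -> 0 < p A -> 0 < e ->
  exists B, [/\ measurable B, B `<=` A, 0 < p B & p B <= e].
Proof.
move=> mA pA e0.
have H n : exists B, [/\ measurable B, B `<=` A, 0 < p B & p B <= p A / 2 ^+ n].
  elim: n => [|n [B [mB BA pB Ble]]]; first by exists A; rewrite expr0 divr1; split.
  have [] := naZ mB; first by rewrite lamE// lte_fin.
  move=> C [mC CB]; rewrite (lamE mC) (lamE mB) !lte_fin => pC CltB.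
  have -> : p A / 2 ^+ n.+1 = p A / 2 ^+ n / 2 by rewrite exprSr invfM mulrA.
  have mBC : measurable (B `\` C) by exact: measurableD.
  have [h|h] := leP (p C) (p B / 2).
    exists C; split => //; first exact: subset_trans BA.
    by apply: (le_trans h); rewrite ler_pM2r.
  exists (B `\` C); rewrite p_setD//; split => //.
  - by apply: subset_trans BA; exact: subDsetl.
  - by rewrite subr_gt0.
  - lra.
have [n _ ne] : exists2 n, True & p A / 2 ^+ n <= e.
  have [n] : exists n, p A / e < 2 ^+ n.
    exists (Num.bound (p A / e)); apply: lt_le_trans (archi_boundP _) _.
      by rewrite divr_ge0// ltW.
    by rewrite -natrX ler_nat ltnW// ltn_expl.
  by exists n => //; rewrite ler_pdivrMr// mulrC -ler_pdivrMr// ltW.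
by have [B [mB BA pB Ble]] := H n; exists B; split => //; exact: le_trans ne.
Qed.

(* Sierpinski's theorem by greedy exhaustion: each step gains at least half of
   the largest possible increase of mass. *)
Lemma nonatomic_subset (A : set Z) (t : R) : measurable A -> 0 <= t <= p A ->
  exists B, [/\ measurable B, B `<=` A & p B = t].
Proof.
move=> mA /andP[t0 tA].
pose good B := [/\ measurable B, B `<=` A & p B <= t].
have step B : exists B', good B ->
    [/\ good B', B `<=` B' &
      forall C, good C -> B `<=` C -> p C - p B <= 2 * (p B' - p B)].
  have [gB|ngB] := pselect (good B); last by exists B.
  pose S := [set p C | C in [set C | good C /\ B `<=` C]].
  have SB : S (p B) by exists B => //; split.
  have supS : has_sup S.
    split; first by exists (p B).
    by exists t => _ [C [[_ _ Ct] _] <-].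
  have leS C : good C -> B `<=` C -> p C <= sup S.
    by move=> gC BC; apply: sup_upper_bound => //; exists C.
  (* Either no good superset has more mass and [B] is kept, or a superset is taken whose mass is
     within half the gap of the supremum. *)
  have [h|h] := leP (sup S) (p B).
    exists B => _; split => // C gC BC.
    by rewrite subrr mulr0 subr_le0 (le_trans (leS _ gC BC)).
  have [|x [C [gC BC] <-]] := @sup_adherent _ S ((sup S - p B) / 2) _ supS.
    by rewrite divr_gt0// subr_gt0.
  move=> hC; exists C => _; split => // D gD BD.
  have := leS _ gD BD; lra.
have [f Hf] := choice step.
pose F n := iter n f set0.
have gF n : good (F n).
  elim: n => [|n IH]; last by have [] := Hf _ IH.
  by split; [exact: measurable0|exact: sub0set|rewrite /F/= measure0].
have FS n : F n `<=` F n.+1 by have [] := Hf _ (gF n).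
have mF n : measurable (F n) by have [] := gF n.
pose U := \bigcup_n F n.
have mU : measurable U by exact: bigcupT_measurable.
have FU n : F n `<=` U by exact: bigcup_sup.
have UA : U `<=` A by move=> x [n _]; have [_ FA _] := gF n; exact: FA.
have cF : p (F n) @[n --> \oo] --> p U.
  apply: fine_cvg; rewrite -lamE//; apply: nondecreasing_cvg_mu => //.
  by apply/nondecreasing_seqP => n; rewrite subsetEset.
have pU : p U <= t.
  apply: (cvgr_to_le cF); apply: nearW => n; by have [] := gF n.
exists U; split => //; apply/eqP; rewrite eq_le pU/= leNgt; apply/negP => Ut.
have [|||C [mC CAU pC Ct]] := @nonatomic_small (A `\` U) (t - p U).
- exact: measurableD.
- by rewrite p_setD// subr_gt0 (lt_le_trans Ut).
- by rewrite subr_gt0.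
have UC0 : U `&` C = set0.
  by apply/seteqP; split => // x [Ux /CAU[]].
have pUC : p (U `|` C) = p U + p C by exact: p_setU.
have gUC : good (U `|` C).
  split; first exact: measurableU.
    by move=> x [/UA//|/CAU[]].
  by rewrite pUC -lerBrDl.
(* The union of [U] and [C] competes at stage [n], so its excess over [F n] is at most twice the
   gain made there, and that gain is at most [p U - p (F n)]. Since this difference tends to [0],
   the positive mass of [C] is contradicted. *)
have bound n : p C <= p U - p (F n).
  have [_ _ /(_ _ gUC)] := Hf _ (gF n).
  have FUC : F n `<=` U `|` C by move=> x Fx; left; exact: FU Fx.
  move=> /(_ FUC); rewrite pUC.
  have : p (f (F n)) <= p U by apply: p_le => //; [exact: (mF n.+1)|exact: (FU n.+1)].
  lra.
have cU : p U - p (F n) @[n --> \oo] --> p U - p U by apply: cvgB => //; exact: cvg_cst.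
have : p C <= p U - p U by apply: (cvgr_to_ge cU); apply: nearW.
by rewrite subrr leNgt pC.
Qed.
End nonatomic.

(** Pieces of the prescribed masses are cut off one after the other. *)
Lemma nonatomic_partition (R : realType) d (Z : measurableType d)
    (lam : probability Z R) (naZ : nonatomic lam) n (t : 'I_n -> R) :
  (forall i, 0 <= t i) -> \sum_i t i = 1 ->
  exists tau : Z -> 'I_n, forall i,
    measurable (tau @^-1` [set i]) /\ lam (tau @^-1` [set i]) = (t i)%:E.
Proof.
case: n t => [t _|n t t0 t1]; first by rewrite big_ord0 => /esym/eqP; rewrite oner_eq0.
pose p A := fine (lam A).
have lamE A : measurable A -> lam A = (p A)%:E.
  by move=> mA; rewrite fineK// fin_num_measure.
(* Labels in [nat] and an arbitrary set [A] let the induction apply to what remains once the last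
   piece is removed. *)
have H m (s : nat -> R) A : (forall i, 0 <= s i) -> measurable A ->
    p A = \sum_(i < m.+1) s i -> exists tau : Z -> nat,
    (forall z, tau z <= m)%N /\ forall i, (i <= m)%N ->
    measurable (A `&` tau @^-1` [set i]) /\ p (A `&` tau @^-1` [set i]) = s i.
  move=> s0; elim: m A => [|m IH] A mA pA.
    exists (fun=> 0%N); split => // i; rewrite leqn0 => /eqP ->.
    rewrite [_ @^-1` _](_ : _ = setT) ?setIT; last exact/seteqP.
    by rewrite pA big_ord1.
  rewrite big_ord_recr/= in pA.
  have [|B [mB BA pB]] := @nonatomic_subset R d Z lam naZ A (s m.+1) mA.
    by rewrite s0 -/(p A) pA lerDr sumr_ge0.
  have mAB : measurable (A `\` B) by exact: measurableD.
  have [|tau [taum Htau]] := IH (A `\` B) mAB.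
    apply: EFin_inj; rewrite -lamE//.
    transitivity (lam A - lam B)%E.
      rewrite -{2}(setIidr BA); apply: measureD => //.
      exact: le_lt_trans (probability_le1 lam mA) (ltry _).
    by rewrite (lamE _ mA) (lamE _ mB) -EFinB pA [p B]pB addrK.
  exists (fun z => if z \in B then m.+1 else tau z); split.
    by move=> z; case: ifP => // _; exact: leqW.
  move=> i; rewrite leq_eqVlt => /predU1P[->|im].
    suff -> : A `&` (fun z => if z \in B then m.+1 else tau z) @^-1` [set m.+1] = B.
      by [].
    apply/seteqP; split => z /=; last first.
      by move=> Bz; rewrite (mem_set Bz); split => //; exact: BA.
    case=> _; case: ifPn => [/set_mem//|_ tz]; have := taum z.
    by rewrite tz ltnn.
  suff -> : A `&` (fun z => if z \in B then m.+1 else tau z) @^-1` [set i] =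
      (A `\` B) `&` tau @^-1` [set i] by exact: Htau.
  apply/seteqP; split => z /= [].
    move=> Az; case: ifPn => [_ mi|/negP zB tz]; first by rewrite -mi ltnn in im.
    by split => //; split => // Bz; apply: zB; exact: mem_set.
  by move=> [Az Bz] tz; split => //; rewrite memNset.
have [||tau [taun Htau]] := H n (fun i => t (inord i)) setT _ measurableT.
- by move=> i; exact: t0.
- rewrite /p probability_setT/= -t1; apply: eq_bigr => i _.
  by rewrite inord_val.
exists (fun z => inord (tau z)) => i.
have -> : (fun z => inord (tau z)) @^-1` [set i] = [set: Z] `&` tau @^-1` [set (i : nat)].
  apply/seteqP; split => z /= => [<-|[_ ->]]; last by rewrite inord_val.
  by rewrite inordK// ltnS.
have [|mi pi] := Htau i; first by rewrite -ltnS.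
by split => //; rewrite (lamE _ mi) pi inord_val.
Qed.

(** * Finite approximation, integral estimates and slices *)

(** The interval from [-M] to [M] is cut into steps of length [e], and [tau] records for every [j]
    in [s] the step that contains the value of [u j]. *)
Lemma finite_approx (R : realType) d (Z : measurableType d) (J : eqType)
    (u : J -> Z -> R) (s : seq J) (M e : R) : 0 < e ->
  (forall j, measurable_fun [set: Z] (u j)) ->
  (forall j z, j \in s -> `|u j z| <= M) ->
  exists (S : finType) (tau : Z -> S),
    (forall i, measurable (tau @^-1` [set i])) /\
    forall z z', tau z = tau z' -> forall j, j \in s -> `|u j z - u j z'| <= e.
Proof.
move=> e0 mu; elim: s => [_|j s IH uM].
  exists unit, (fun=> tt); split => // i.
  by rewrite [_ @^-1` _](_ : _ = setT)//; apply/seteqP; split => // z _; case: i.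
have [k z ks|S [tau [mtau Htau]]] := IH; first by apply: uM; rewrite inE ks orbT.
have {}uM z : `|u j z| <= M by apply: uM; exact: mem_head.
pose h z := (u j z + M) / e.
have h0 z : 0 <= h z.
  by apply: divr_ge0 (ltW e0); have := uM z; rewrite ler_norml; lra.
(* The rescaled value [h z] lies between [0] and [2 * M / e], so [N.+1] labels suffice. *)
pose N := Num.truncn (2 * M / e).
have hN z : (Num.truncn (h z) < N.+1)%N.
  rewrite ltnS; apply: le_truncn; rewrite ler_pM2r ?invr_gt0//.
  by have := uM z; rewrite ler_norml; lra.
exists (S * 'I_N.+1)%type, (fun z => (tau z, Ordinal (hN z))); split.
  case=> i k.
  rewrite [_ @^-1` _](_ : _ = tau @^-1` [set i] `&`
     (h @^-1` [set` `[k%:R, k.+1%:R[ ])); last first.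
    apply/seteqP; split => z /=.
      case=> -> <- /=; split => //.
      by rewrite in_itv/= truncn_itv.
    rewrite in_itv/= => -[-> /truncn_def hk]; congr pair; exact/val_inj.
  apply: measurableI => //; rewrite -[X in measurable X]setTI.
  have mh : measurable_fun [set: Z] h.
    by apply: measurable_funM => //; apply: measurable_funD.
  exact: mh.
move=> z z' [tz hz] k; rewrite inE => /predU1P[->|]; last exact: Htau.
have /andP[a1 a2] := truncn_itv (h0 z).
have /andP[b1 b2] := truncn_itv (h0 z').
have : `|h z - h z'| <= 1.
  rewrite ler_norml; rewrite hz in a1 a2; rewrite -natr1 in a2 b2; lra.
have -> : h z - h z' = (u j z - u j z') / e by rewrite /h -mulrBl; congr (_ / _); lra.
by rewrite normrM (@gtr0_norm _ e^-1) ?invr_gt0// ler_pdivrMr// mul1r.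
Qed.

(** The functions may differ by an extra [M] on an exceptional set [B]; for uniformly close
    functions [B] is taken empty. *)
Lemma Rintegral_close (R : realType) d (X : measurableType d)
    (mu : probability X R) (u v : X -> R) (e M : R) (B : set X) :
  mu.-integrable [set: X] (EFin \o u) -> mu.-integrable [set: X] (EFin \o v) ->
  measurable B -> (forall x, `|u x - v x| <= e + M * \1_B x) ->
  `|\int[mu]_x u x - \int[mu]_x v x| <= e + M * fine (mu B).
Proof.
move=> iu iv mB uv; rewrite -RintegralB//.
have iB : mu.-integrable [set: X] (EFin \o (\1_B : X -> R)).
  apply: (@bounded_integrable _ _ _ _ _ 1) => // x.
  by rewrite indicE; case: (_ \in _); rewrite ?normr1 ?normr0.
have ic (c : R) : mu.-integrable [set: X] (EFin \o (fun=> c)).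
  exact: (@bounded_integrable _ _ _ _ _ `|c|).
have iMB : mu.-integrable [set: X] (EFin \o (fun x => M * \1_B x)).
  rewrite (_ : EFin \o _ = fun x => (M%:E * (EFin \o (\1_B : X -> R)) x)%E)//.
  exact: integrableZl.
have iuv : mu.-integrable [set: X] (EFin \o (fun x => u x - v x)).
  rewrite (_ : EFin \o _ = (EFin \o u) \- (EFin \o v))%E//.
  exact: integrableB.
apply: (le_trans (le_normr_Rintegral _ iuv)) => //.
apply: (@le_trans _ _ (\int[mu]_x (e + M * \1_B x))).
  apply: le_Rintegral => //.
    exact: integrable_norm.
  rewrite (_ : EFin \o _ = ((EFin \o (fun=> e)) \+ (EFin \o (fun x => M * \1_B x)%R))%E)//.
  exact: integrableD.
rewrite RintegralD// Rintegral_cst// RintegralZl//.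
rewrite /Rintegral integral_indic// setIT.
rewrite [X in e * X](_ : _ = 1) ?mulr1//.
exact: (congr1 fine (probability_setT mu)).
Qed.

Section slices.
Context (R : realType) dY (Y : measurableType dY)
  (nu : probability Y R) dZ (Z : measurableType dZ) (lam : probability Z R).
Context (F : Z * Y -> R) (M : R) (mF : measurable_fun [set: Z * Y] F)
  (FM : forall x, `|F x| <= M).

Let iF : (lam \x nu)%E.-integrable [set: Z * Y] (EFin \o F).
Proof. exact: (@bounded_integrable _ _ _ (lam \x nu)%E _ M). Qed.

Let islice z : nu.-integrable [set: Y] (EFin \o (fun y => F (z, y))).
Proof.
by apply: (@bounded_integrable _ _ _ _ _ M) => //; exact: measurable_fun_pair2.
Qed.

Let sliceE z : fubini_F nu (EFin \o F) z = (\int[nu]_y F (z, y))%:E.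
Proof.
by rewrite /Rintegral fineK//; exact: (integrable_fin_num measurableT (islice z)).
Qed.

Lemma measurable_slice : measurable_fun [set: Z] (fun z => \int[nu]_y F (z, y)).
Proof.
apply/measurable_EFinP.
rewrite (_ : EFin \o _ = fubini_F nu (EFin \o F)); last first.
  by apply/funext => z; rewrite sliceE.
exact: (measurable_fubini_F iF).
Qed.

Lemma slice_bounded z : `|\int[nu]_y F (z, y)| <= M.
Proof.
have := @Rintegral_close _ _ _ nu (fun y => F (z, y)) (fun=> 0) M 0 set0 (islice z).
rewrite measure0 mul0r addr0 (_ : Rintegral nu setT (fun=> 0) = 0); last first.
  by rewrite Rintegral_cst// mul0r.
rewrite subr0; apply => //.
- by apply: (@bounded_integrable _ _ _ nu _ 0) => // x; rewrite normr0.
- by move=> x; rewrite subr0 mul0r addr0.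
Qed.

Lemma Rintegral_slices :
  \int[(lam \x nu)%E]_x F x = \int[lam]_z \int[nu]_y F (z, y).
Proof.
rewrite /Rintegral -(integral12_prod_meas1 iF); congr fine.
by apply: eq_integral => z _; exact: sliceE.
Qed.

End slices.

(** * The product with a trivial action and the closed convex hull *)

Section convex_hull_product.
Context (R : realType) (G : groupType) (cG : countable [set: G]).
Context dY (Y : measurableType dY) (nu : probability Y R) (b : G -> Y -> Y)
  (hb : invariant_action nu b).
Context dZ (Z : measurableType dZ) (lam : probability Z R).
Context (K : ptopologicalType) (cK : compact [set: K]) (sK : @second_countable K).
Local Notation c := (diag_action (@trivial_action G Z) b).
Local Notation hc := (trivial_diag_invariant lam hb).

(** Cut [Z] into pieces of masses [t i] and follow [phi i] over the [i]-th piece. The action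
    preserves the pieces, so the law of the glued map is the given combination. *)
Lemma convex_hull_sub_E (naZ : nonatomic lam) :
  convex_hull (E_set K nu b) `<=` E_set K (lam \x nu)%E c.
Proof.
move=> m [n [t [e [t0 t1 Ee mE]]]].
have /choice[phi Hphi] i : exists phi : Y -> K,
    measurable_fun [set: Y] (phi : Y -> borel K) /\
    forall A : set (borel (power G K)), measurable A ->
      Ms_prob (e i) A = nu (orbit_map b phi @^-1` A).
  by have [phi mphi eE] := Ee i; exists phi.
have [tau Htau] := nonatomic_partition naZ t0 t1.
have mtau i : measurable (tau @^-1` [set i]) by have [] := Htau i.
exists (fun zy => phi (tau zy.1) zy.2).
  move=> _ B mB; rewrite setTI.
  apply: (@measurable_mixture _ _ _ _ _ tau mtau (fun i => phi i @^-1` B)) => i.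
  by rewrite -[_ @^-1` _]setTI; apply: (Hphi i).1.
move=> A mA; rewrite mE// /pushforward.
pose B i := orbit_map b (phi i) @^-1` A.
transitivity (\sum_(i < n) lam (tau @^-1` [set i]) * nu (B i))%E.
  by apply: eq_bigr => i _; rewrite (Htau i).2 (Hphi i).2.
symmetry; apply: (mixture_measure nu lam mtau) => i.
rewrite -[B i]setTI; apply: (measurable_orbit_map cG sK hb (Hphi i).1) => //.
Qed.

Lemma E_sub_closed_convex_hull :
  E_set K (lam \x nu)%E c `<=` closed_convex_hull (E_set K nu b).
Proof.
move=> m [phi mphi mE]; apply/closure_MsP => D e fD e0.
have [s Ds] := (@finite_seqP _ D).1 fD.
have /choice[Mf HM] (f : continuousType (power G K) R) : exists M : R,
    forall x, `|f x| <= M.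
  have [M _ fM] := continuous_compact_bounded (power_compact cK) (@cts_fun _ _ f).
  by exists M.
pose Phi := orbit_map c phi.
(* [u f z] is the integral of [f] against the member of [E(b, K)] defined by the slice of [phi] at
   [z]. *)
pose u (f : continuousType (power G K) R) z := \int[nu]_y f (Phi (z, y)).
have mfPhi (f : continuousType (power G K) R) : measurable_fun [set: Z * Y] (fun x => f (Phi x)).
  exact: (measurable_orbit_comp cG sK hc mphi).
(* The bounds from [HM] depend on the function; the discretization needs one bound common to all
   tests in [D]. *)
have [M _ HMs] := compact_uniform_bound (power_compact cK) fD.
have mu_ f : measurable_fun [set: Z] (u f).
  exact: (measurable_slice nu lam (mfPhi f) (fun x => HM f (Phi x))).
have uM f z : f \in s -> `|u f z| <= M.
  move=> fs; have Df : D f by rewrite Ds.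
  exact: (slice_bounded nu (mfPhi f) (fun x => HMs f Df (Phi x))).
have e2 : 0 < e / 2 by rewrite divr_gt0.
have [S [tau [mtau Htau]]] := finite_approx e2 mu_ uM.
(* Freezing [z] to a representative of its class turns [phi] into a finite
   mixture, whose measure is a convex combination. *)
pose tau' z := enum_rank (tau z).
(* An empty cell is represented by [point], and its weight in the combination is [0]. *)
pose rep (i : 'I_#|S|) := xget point (tau @^-1` [set enum_val i]).
have taurep z : tau (rep (tau' z)) = tau z.
  rewrite /rep /tau' enum_rankK; case: xgetP => [y -> //|/(_ z)]; by case.
have mtau' i : measurable (tau' @^-1` [set i]).
  suff -> : tau' @^-1` [set i] = tau @^-1` [set enum_val i] by [].
  by apply/seteqP; split => z /=; [move=> <-; rewrite enum_rankK|
    move=> tz; rewrite /tau' tz enum_valK].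
pose psi i y := phi (rep i, y).
have mpsi i : measurable_fun [set: Y] (psi i : Y -> borel K).
  exact: (measurable_fun_pair2 (f := phi : Z * Y -> borel K)).
have mpsi' : measurable_fun [set: Z * Y] ((fun zy => psi (tau' zy.1) zy.2) : _ -> borel K).
  move=> _ B mB; rewrite setTI.
  apply: (@measurable_mixture _ _ _ _ _ tau' mtau' (fun i => psi i @^-1` B)) => i.
  by rewrite -[_ @^-1` _]setTI; apply: mpsi.
(* [m'] has two descriptions: a convex combination of the [ei], which puts it in the hull, and an
   orbit law on the product, whose integrals can be sliced over [Z]. *)
have [m' m'E] := orbit_Ms cG sK hc mpsi'.
have /choice[ei eiE] i := orbit_Ms cG sK hb (mpsi i).
have mB i (A : set (borel (power G K))) : measurable A -> measurable (orbit_map b (psi i) @^-1` A).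
  move=> mA; rewrite -[_ @^-1` A]setTI.
  by apply: (measurable_orbit_map cG sK hb (mpsi i)).
exists m'.
  exists #|S|, (fun i => fine (lam (tau' @^-1` [set i]))), ei; split.
  - by move=> i; exact: fine_ge0.
  - apply: EFin_inj; rewrite -sumEFin.
    transitivity ((lam \x nu)%E [set: Z * Y]); last exact: probability_setT.
    symmetry; rewrite [LHS](mixture_measure nu lam mtau' (B := fun=> setT) (fun=> measurableT)).
    apply: eq_bigr => i _.
    by rewrite [X in (_ * X)%E](probability_setT nu) mule1 fineK// fin_num_measure.
  - by move=> i; exists (psi i) => // A mA; exact: eiE.
  - move=> A mA; rewrite m'E//.
    transitivity (\sum_(i < #|S|) lam (tau' @^-1` [set i]) *
        nu (orbit_map b (psi i) @^-1` A))%E.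
      apply: (mixture_measure nu lam mtau' (B := fun i => orbit_map b (psi i) @^-1` A)).
      by move=> i; exact: mB.
    apply: eq_bigr => i _; rewrite eiE// fineK// fin_num_measure//.
move=> f; rewrite Ds/= => fs.
rewrite (expect_orbit cG sK hc mphi cK f mE) (expect_orbit cG sK hc mpsi' cK f m'E).
have mfPsi := measurable_orbit_comp cG sK hc mpsi' f.
rewrite (Rintegral_slices nu lam (mfPhi f) (fun x => HM f _)).
rewrite (Rintegral_slices nu lam mfPsi (fun x => HM f _)).
have := @Rintegral_close _ _ _ lam (u f) (fun z => u f (rep (tau' z))) (e / 2) 0 set0.
rewrite mul0r addr0 => H; apply: le_lt_trans (H _ _ _ _) _ => //.
- by apply: (@bounded_integrable _ _ _ _ _ M) => // z; exact: uM.
- apply: (@bounded_integrable _ _ _ _ _ M) => [|z]; last exact: uM.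
  exact: (measurable_slice nu lam mfPsi (fun x => HM f _)).
- by move=> z; rewrite mul0r addr0; exact: Htau.
- by rewrite ltr_pdivrMr// ltr_pMr// ltr1n.
Qed.

End convex_hull_product.

(** * From weak containment to closures of orbit laws *)

Lemma measurable_fin_preimage d (W : measurableType d) (S : finType) (tau : W -> S)
    (P : set S) : (forall i, measurable (tau @^-1` [set i])) ->
  measurable (tau @^-1` P).
Proof.
move=> mtau; have -> : tau @^-1` P = \bigcup_(i in P) tau @^-1` [set i].
  by apply/seteqP; split => [w Pw|w [i Pi /= ->//]]; exists (tau w).
by apply: fin_bigcup_measurable => // i _; exact: mtau.
Qed.

Lemma Rintegral_finite (R : realType) d (X : measurableType d)
    (mu : probability X R) (S : finType) (tau : X -> S) (v : S -> R) :
  (forall i, measurable (tau @^-1` [set i])) ->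
  \int[mu]_x v (tau x) = \sum_i v i * fine (mu (tau @^-1` [set i])).
Proof.
move=> mtau; rewrite /Rintegral.
have E x : (v (tau x))%:E = (\sum_i (v i)%:E * (\1_(tau @^-1` [set i]) x)%:E)%E.
  rewrite (bigD1 (tau x))//= indicE mem_set// mule1 big1 ?adde0// => i /eqP it.
  by rewrite indicE memNset ?mule0// => /= h; apply: it.
under eq_integral do rewrite E.
have iI i : mu.-integrable [set: X] (fun x => (\1_(tau @^-1` [set i]) x)%:E).
  exact: integrable_indic.
rewrite integral_sum//; last by move=> i; apply: integrableZl.
rewrite [X in fine X](_ : _ = (\sum_i v i * fine (mu (tau @^-1` [set i])))%:E)//.
rewrite -sumEFin; apply: eq_bigr => i _.
rewrite integralZl// integral_indic// setIT EFinM fineK// fin_num_measure//.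
Qed.

(* A continuous function on the power is almost determined by finitely many
   coordinates, each known only up to finitely many Borel classes. *)
Lemma cylinder_label (R : realType) (G : groupType) (K : ptopologicalType)
    (cK : compact [set: K]) (D : set (continuousType (power G K) R)) (e : R) :
  finite_set D -> 0 < e ->
  exists (gs : seq G) (L : finType) (lab : borel K -> L),
    (forall l, measurable (lab @^-1` [set l])) /\
    forall q q' : power G K, (forall g, g \in gs -> lab (q g) = lab (q' g)) ->
      forall f, D f -> `|f q - f q'| <= e.
Proof.
move=> fD e0; have e2 : 0 < e / 2 by rewrite divr_gt0.
(* Around each [p], a box given by finitely many coordinates on which every test in [D] stays within
   [e / 2] of its value at [p]; compactness then leaves finitely many boxes. *)
have /choice[gV HgV] (p : power G K) : exists gV : seq G * (G -> set K),
    (forall g, open (gV.2 g)) /\ (forall g, gV.2 g (p g)) /\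
    forall q : power G K, (forall g, g \in gV.1 -> gV.2 g (q g)) ->
      forall f, D f -> `|f p - f q| < e / 2.
  have : nbhs p (\bigcap_(f in D) [set q | `|f p - f q| < e / 2]).
    have [s Ds] := (@finite_fsetP _ D).1 fD; rewrite Ds.
    apply: filter_bigI => f _.
    exact: (@cts_fun _ _ f p (ball (f p) (e / 2)) (nbhsx_ballx _ _ e2)).
  move=> /nbhs_prod_box[J [V [fJ oV Vp VD]]].
  have [s Js] := (@finite_seqP _ J).1 fJ.
  exists (s, V); split => //; split => // q qV f Df /=.
  by apply: (VD q) => // g; rewrite Js; exact: qV.
pose O p := [set q : power G K | forall g, g \in (gV p).1 -> (gV p).2 g (q g)].
have nO p : nbhs p (O p).
  rewrite (_ : O p = \bigcap_(g in [set` [fset x | x in (gV p).1]%fset])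
      (fun q : power G K => q g) @^-1` (gV p).2 g); last first.
    apply/seteqP; split => q qV g /=.
      by rewrite !inE => gp; exact: qV.
    by move=> gp; apply: (qV g); rewrite /= !inE.
  apply: filter_bigI => g _; apply: prod_proj_continuous.
  by apply: open_nbhs_nbhs; have [oV [Vp _]] := HgV p; split.
have := power_compact (I := G) cK; rewrite compact_cover.
move=> /(_ _ setT (fun p => (O p)°)) [p _|p _|P _ PO].
- exact: open_interior.
- by exists p => //; exact: nO.
pose s := flatten [seq [seq (p, g) | g <- (gV p).1] | p <- enum_fset P].
pose gs := flatten [seq (gV p).1 | p <- enum_fset P].
(* Indicators of the sides of the chosen boxes. Two values at distance at most [1 / 2] are equal, so
   points with the same label lie in the same sides. *)
pose u (pg : power G K * G) : borel K -> R := \1_((gV pg.1).2 pg.2).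
have mu pg : measurable_fun [set: borel K] (u pg).
  apply: measurable_indic; apply: sub_sigma_algebra.
  by have [] := HgV pg.1.
have [|pg k _|L [lab [mlab Hlab]]] := @finite_approx R _ (borel K) _ u s 1 (1 / 2) _ mu.
- by rewrite divr_gt0.
- by rewrite /u indicE; case: (_ \in _); rewrite ?normr1 ?normr0.
exists gs, L, lab; split => // q q' qq' f Df.
have [p /= pP /interior_subset qO] := PO q I.
have pgs g : g \in (gV p).1 -> g \in gs.
  by move=> gp; apply/flattenP; exists (gV p).1 => //; apply/mapP; exists p.
have q'O : O p q'.
  move=> g gp; have := Hlab _ _ (qq' g (pgs _ gp)) (p, g).
  have -> : (p, g) \in s.
    by apply/flattenP; exists [seq (p, g) | g <- (gV p).1]; apply/mapP; [exists p|exists g].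
  move=> /(_ isT); rewrite /u !indicE/= (mem_set (qO g gp)).
  have [/set_mem//|_] := boolP (_ \in _).
  rewrite /= subr0 normr1; lra.
have [_ [_ H]] := HgV p.
have := H _ qO f Df; have := H _ q'O f Df.
rewrite !ltr_norml !ler_norml; lra.
Qed.

Lemma lte_dist_fin (R : realType) (x y : \bar R) (e : R) :
  x \is a fin_num -> y \is a fin_num ->
  (`|x - y| < e%:E)%E = (`|fine x - fine y| < e).
Proof. by case: x y => [x| |] [y| |]. Qed.

Lemma measure_bigcup_le (R : realType) d (W : measurableType d)
    (nu : probability W R) (J : finType) (P : set J) (C : J -> set W) (e : R) :
  0 <= e -> (forall j, measurable (C j)) ->
  (forall j, P j -> fine (nu (C j)) <= e) ->
  fine (nu (\bigcup_(j in P) C j)) <= #|J|%:R * e.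
Proof.
move=> e0 mC Ce; pose C' j := if `[< P j >] then C j else set0.
have mC' j : measurable (C' j) by rewrite /C'; case: ifP.
have -> : \bigcup_(j in P) C j = \big[setU/set0]_(j <- enum J) C' j.
  rewrite -bigcup_seq; apply/seteqP; split => x [j /= Pj].
    by move=> Cx; exists j; rewrite /= ?mem_enum// /C' asboolT.
  by rewrite /C'; case: asboolP => // Pj' Cx; exists j.
rewrite cardE; elim: (enum J) => [|j s IH].
  by rewrite big_nil measure0 mul0r.
rewrite big_cons -natr1 mulrDl mul1r addrC.
have mS : measurable (\big[setU/set0]_(j <- s) C' j) by exact: bigsetU_measurable.
apply: (@le_trans _ _ (fine (nu (C' j)) + fine (nu (\big[setU/set0]_(j <- s) C' j)))).
  rewrite -lee_fin EFinD !fineK ?fin_num_measure//; last exact: measurableU.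
  exact: measureU2.
apply: lerD => //; rewrite /C'; case: asboolP => [/Ce //|_].
by rewrite measure0.
Qed.

Section weak_containment.
Context (R : realType) (G : groupType) (cG : countable [set: G]).
Context dX (X : measurableType dX) (mu : probability X R) (a : G -> X -> X)
  (ha : invariant_action mu a).
Context dW (W : measurableType dW) (nu : probability W R) (c : G -> W -> W)
  (hc : invariant_action nu c).

(** Weak containment is phrased with images, while measurability and invariance concern
    preimages. *)
Lemma image_action d (T : measurableType d) (m : probability T R) (t : G -> T -> T)
    (g : G) (A : set T) : invariant_action m t ->
  t g @` A = t (g^-1)%g @^-1` A.
Proof.
move=> ht; apply/seteqP; split => [_ [x Ax <-] /=|x /= Ax].
  by rewrite -(inv_actM ht) mulVg (inv_act1 ht).
by exists (t (g^-1)%g x) => //; rewrite -(inv_actM ht) mulgV (inv_act1 ht).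
Qed.

Lemma measurable_image_action d (T : measurableType d) (m : probability T R)
    (t : G -> T -> T) (g : G) (A : set T) : invariant_action m t ->
  measurable A -> measurable (t g @` A).
Proof.
move=> ht mA; rewrite (image_action _ _ ht) -[_ @^-1` _]setTI.
exact: (inv_measurable ht).
Qed.

Lemma borel_partition_index d (T : measurableType d) n (A : 'I_n -> set T) :
  borel_partition A -> exists tau : T -> 'I_n, forall i, tau @^-1` [set i] = A i.
Proof.
move=> [mA tA AT]; have /choice[tau Htau] x : exists i, A i x.
  by have : (\bigcup_i A i) x by [rewrite AT]; move=> [i _ Ai]; exists i.
exists tau => i; apply/seteqP; split => x /= => [<- //|Aix].
apply: contrapT => /eqP ne; move/trivIsetP : tA => /(_ _ _ I I ne).
by move=> /seteqP[/(_ x) + _]; apply; split.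
Qed.

Lemma index_borel_partition d (T : measurableType d) n (tau : T -> 'I_n) :
  (forall i, measurable (tau @^-1` [set i])) ->
  borel_partition (fun i => tau @^-1` [set i]).
Proof.
move=> mtau; split => //.
  apply/trivIsetP => i j _ _ /eqP ij; apply/seteqP; split => // x [/= ti tj].
  by apply: ij; rewrite -ti.
by apply/seteqP; split => // x _; exists (tau x).
Qed.

(* The cells [A] of the partition of [X] record the labels of all the coordinates
   of the orbit map in [1 :: gs].  If [g A_s] misses [A_t], then [g B_s] almost
   misses [B_t]; off these small sets [Bad], the first label of the cell of
   [g^-1 w] is the [g]-label of the cell of [w], so the labels recorded by [B]
   are those of an actual orbit map. *)
Lemma weakly_contained_E (K : ptopologicalType) (cK : compact [set: K])
    (sK : @second_countable K) :
  weakly_contained mu a nu c -> E_set K mu a `<=` closure (E_set K nu c).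
Proof.
move=> wac m [phi mphi mE]; apply/closure_MsP => D e fD e0.
have e4 : 0 < e / 4 by rewrite divr_gt0.
have [gs [L [lab [mlab Hlab]]]] := cylinder_label cK fD e4.
have [M M0 HM] := compact_uniform_bound (power_compact cK) fD.
pose n := size gs.
(* Index [0] is the identity, so coordinate [ord0] of a cell is the label of [phi] at the point
   itself. *)
pose g (i : 'I_n.+1) : G := nth 1%g (1%g :: gs) i.
have gsP h : h \in gs -> exists i, g i = h.
  move=> hgs; have lt : ((index h gs).+1 < n.+1)%N by rewrite ltnS index_mem.
  by exists (Ordinal lt); rewrite /g /= nth_index.
pose T : finType := {ffun 'I_n.+1 -> L}.
pose t (x : X) : T := [ffun i => lab (phi (a (g i)^-1%g x))].
pose N := #|T|.
pose tau x : 'I_N := enum_rank (t x).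
have mtau i : measurable (tau @^-1` [set i]).
  have -> : tau @^-1` [set i] = \bigcap_j
     (fun x => lab (phi (a (g j)^-1%g x))) @^-1` [set (enum_val i : T) j].
    apply/seteqP; split => x /=.
      by move=> <- j _ /=; rewrite /tau enum_rankK ffunE.
    move=> H; rewrite /tau -[RHS]enum_valK; congr enum_rank.
    by apply/ffunP => j; rewrite ffunE; exact: (H j I).
  apply: fin_bigcap_measurable => // j _.
  rewrite -[_ @^-1` _]setTI.
  have mp := measurableT_comp mphi (inv_measurable ha (g j)^-1%g).
  have := mp measurableT (lab @^-1` [set (enum_val i : T) j]); apply.
  exact: mlab.
pose A i := tau @^-1` [set i].
(* The first term pays for [Bad], a union of at most [n.+1 * N * N] sets, the second for the change
   of mass of the [N] cells; [1] keeps [Q] positive. *)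
pose Q : R := 2 * M * (n.+1 * N * N)%:R + M * N%:R + 1.
have Q0 : 0 < Q by rewrite ltr_wpDl// addr_ge0// !mulr_ge0.
pose dl := e / 4 / Q.
have dl0 : 0 < dl by rewrite divr_gt0.
have [B pB HB] := wac N A (range g) dl (index_borel_partition mtau)
  (finite_image _ (@finite_finset _ _)) dl0.
have [sg sgB] := borel_partition_index pB.
have mB i : measurable (B i) by have [] := pB.
have msg i : measurable (sg @^-1` [set i]) by rewrite sgB.
(* A point of [K] with label [l], or [point] if the label is not attained. *)
pose kap (l : L) : K := xget point (lab @^-1` [set l]).
pose psi w := kap ((enum_val (sg w) : T) ord0).
have mpsi : measurable_fun [set: W] (psi : W -> borel K).
  move=> _ U mU; rewrite setTI.
  exact: (measurable_fin_preimage
    [set i | U (kap ((enum_val i : T) ord0))] msg).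
have [m' m'E] := orbit_Ms cG sK hc mpsi.
exists m'; first by exists psi.
move=> f Df.
rewrite (expect_orbit cG sK ha mphi cK f mE) (expect_orbit cG sK hc mpsi cK f m'E).
pose Phi := orbit_map a phi; pose Psi := orbit_map c psi.
pose rx i := xget point (A i).
pose v i := f (Phi (rx i)).
pose null (j : 'I_n.+1 * 'I_N * 'I_N) := `[< a (g j.1.1) @` A j.1.2 `&` A j.2 = set0 >].
pose cell (j : 'I_n.+1 * 'I_N * 'I_N) := c (g j.1.1) @` B j.1.2 `&` B j.2.
have mcell j : measurable (cell j).
  by apply: measurableI => //; exact: (measurable_image_action _ hc).
pose Bad := \bigcup_(j in [set j | null j]) cell j.
have mBad : measurable Bad by apply: fin_bigcup_measurable.
have agree_lab x y : (forall i, (enum_val (tau x) : T) i = lab (Psi y (g i))) ->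
    forall h, h \in gs -> lab (Psi y h) = lab (Phi x h).
  by move=> H h /gsP[i <-]; rewrite -H /tau enum_rankK ffunE.
have rxP x i : A i x -> A i (rx i).
  by move=> Aix; rewrite /rx; case: xgetP => [y -> //|/(_ x)].
have closeX x : `|f (Phi x) - v (tau x)| <= e / 4 + 0 * \1_set0 x.
  rewrite mul0r addr0; apply: Hlab Df => h /gsP[i <-].
  have : tau (rx (tau x)) = tau x by exact: (rxP x).
  rewrite /tau => /enum_rank_inj/ffunP/(_ i); by rewrite !ffunE.
have closeW w : `|f (Psi w) - v (sg w)| <= e / 4 + (2 * M) * \1_Bad w.
  rewrite indicE; have [_|wBad] := boolP (w \in Bad).
    rewrite mulr1; apply: (@le_trans _ _ (2 * M)); last by rewrite lerDr ltW.
    apply: (le_trans (ler_normB _ _)).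
    by rewrite mulr2n mulrDl mul1r lerD ?HM.
  rewrite mulr0 addr0.
  (* Off [Bad], the cells of [w] and of its translate by the inverse of [g j] are realized by a
     point of [X] and its translate. The case [ord0] shows that the cell of [w] is nonempty in
     [X]. *)
  have hit j : exists x, A (sg w) x /\ A (sg (c (g j)^-1%g w)) (a (g j)^-1%g x).
    apply: contrapT => H; move/negP: wBad; apply; apply/mem_set.
    exists (j, sg (c (g j)^-1%g w), sg w).
      apply/asboolP => /=; rewrite (image_action _ _ ha).
      by apply/seteqP; split => // x [/= Ax1 Ax2]; apply: H; exists x.
    rewrite /cell (image_action _ _ hc); split; by rewrite /= -sgB.
  have [x0 [Ax0 _]] := hit ord0.
  have Arx : tau (rx (sg w)) = sg w := rxP _ _ Ax0.
  apply: Hlab Df; apply: agree_lab => i; rewrite Arx.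
  have [x [Ax Aax]] := hit i.
  have lx : (enum_val (sg w) : T) i = lab (phi (a (g i)^-1%g x)).
    by rewrite -Ax /tau enum_rankK ffunE.
  have -> : Psi w (g i) = kap ((enum_val (sg w) : T) i).
    rewrite /Psi /orbit_map /psi -Aax /tau enum_rankK ffunE lx.
    by rewrite /g /= invg1 (inv_act1 ha).
  rewrite /kap lx; case: xgetP => [k _ /= -> //|/(_ (phi (a (g i)^-1%g x)))].
  by case.
have iPhi := integrable_orbit_comp cG sK ha mphi cK f.
have iPsi := integrable_orbit_comp cG sK hc mpsi cK f.
have iv d (S : measurableType d) (P : probability S R) (h : S -> 'I_N) :
    (forall i, measurable (h @^-1` [set i])) ->
    P.-integrable [set: S] (EFin \o (fun x => v (h x))).
  move=> mh; apply: (@bounded_integrable _ _ _ _ _ M); last by move=> x; exact: HM.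
  move=> _ U mU; rewrite setTI.
  exact: (measurable_fin_preimage (v @^-1` U) mh).
have := Rintegral_close iPhi (iv _ _ mu _ mtau) measurable0 closeX.
have := Rintegral_close iPsi (iv _ _ nu _ msg) mBad closeW.
rewrite !Rintegral_finite// mul0r addr0 -/Phi -/Psi.
have g1 : g ord0 = 1%g by [].
have HBr i k l : `|fine (mu (a (g i) @` A k `&` A l)) - fine (nu (cell (i, k, l)))| < dl.
  have mX : measurable (a (g i) @` A k `&` A l).
    by apply: measurableI; [exact: (measurable_image_action _ ha (mtau k))|exact: mtau].
  rewrite -lte_dist_fin; [|exact: fin_num_measure|exact: fin_num_measure].
  exact: HB (g i) k l (ex_intro2 _ _ i I erefl).
(* Taking the identity and the pair [(i, i)] in the estimate compares the masses of the cells
   themselves. *)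
have diag i : `|fine (mu (A i)) - fine (nu (B i))| <= dl.
  have := HBr ord0 i i; rewrite /cell/= g1 (image_action _ _ ha) (image_action _ _ hc) invg1.
  have -> : a 1%g @^-1` A i = A i by apply/seteqP; split => x /=; rewrite (inv_act1 ha).
  have -> : c 1%g @^-1` B i = B i by apply/seteqP; split => x /=; rewrite (inv_act1 hc).
  by rewrite !setIid => /ltW.
have bad : fine (nu Bad) <= (n.+1 * N * N)%:R * dl.
  have -> : (n.+1 * N * N = #|{: 'I_n.+1 * 'I_N * 'I_N}|)%N by rewrite !card_prod !card_ord.
  apply: measure_bigcup_le => [|//|[[i k] l] /asboolP /= nul]; first exact: ltW.
  have := HBr i k l; rewrite nul measure0 sub0r normrN.
  by move=> /ltW; apply: le_trans; exact: ler_norm.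
have diff : `|\sum_i v i * fine (mu (A i)) - \sum_i v i * fine (nu (B i))| <= M * N%:R * dl.
  rewrite -sumrB; apply: (le_trans (ler_norm_sum _ _ _)).
  apply: (@le_trans _ _ (\sum_(i < N) M * dl)).
    apply: ler_sum => i _; rewrite -mulrBr normrM.
    by apply: ler_pM => //; exact: HM.
  by rewrite sumr_const card_ord -[X in X <= _]mulr_natr mulrAC.
(* The two discretizations cost [e / 4] each, and [Bad] with the change of masses costs a third
   quarter, for a total below [e]. *)
have tot : 2 * M * fine (nu Bad) + M * N%:R * dl <= e / 4.
  apply: (@le_trans _ _ (Q * dl)); last by rewrite /dl mulrC divfK ?gt_eqF.
  have : 2 * M * fine (nu Bad) <= 2 * M * ((n.+1 * N * N)%:R * dl).
    by rewrite ler_wpM2l// mulr_ge0.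
  rewrite /Q mulrA; move: (dl) dl0 => y y0.
  move=> h; rewrite [leRHS]mulrDl [X in _ <= X + _]mulrDl mul1r -[leRHS]addrA.
  by rewrite lerD// lerDl ltW.
rewrite (eq_bigr (fun i => v i * fine (nu (B i)))); last by move=> i _; rewrite sgB.
move: diff tot; rewrite /A; set I1 := Rintegral _ _ _; set I2 := Rintegral _ _ _.
set s1 := \sum_(i < _) _; set s2 := \sum_(i < _) _.
rewrite !ler_norml !ltr_norml; lra.
Qed.

End weak_containment.

(* The scalar field is a phantom parameter, from which the metric structure is
   inferred. *)
Definition finite_space (R : realType) (k : nat) : Type := 'I_k.+1.

(** * Finite discrete spaces are compact and Polish *)

Section finite_space.
Context (R : realType) (k : nat).
Local Notation T := (finite_space R k).

HB.instance Definition _ := Choice.copy T 'I_k.+1.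
HB.instance Definition _ := isPointed.Build T (ord0 : 'I_k.+1).

Let fdist (x y : T) : R := (x != y)%:R.

Let fdistxx x : fdist x x = 0.
Proof. by rewrite /fdist eqxx. Qed.

Let fdist_positivity x y : fdist x y = 0 -> x = y.
Proof. by rewrite /fdist; case: eqP => // _ /eqP; rewrite oner_eq0. Qed.

Let fdist_sym x y : fdist x y = fdist y x.
Proof. by rewrite /fdist eq_sym. Qed.

Let fdist_triangle y x z : fdist x z <= fdist x y + fdist y z.
Proof.
rewrite /fdist; have [<-|xy] := eqVneq x y; first by rewrite add0r.
by rewrite -[leLHS]addr0 lerD// ler_nat; case: (x != z).
Qed.

HB.instance Definition _ := isMetric.Build R T
  fdistxx fdist_positivity fdist_sym fdist_triangle.

Lemma finite_space_open (A : set T) : open A.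
Proof.
rewrite openE => x Ax; apply/nbhs_ballP; exists 1 => //= y.
rewrite ballEmdist/= (_ : mdist x y = (x != y)%:R)//.
by have [<-|] := eqVneq x y; rewrite ?ltxx.
Qed.

Lemma finite_space_compact : compact [set: T].
Proof. exact/finite_compact/(@finite_finset 'I_k.+1). Qed.

Lemma finite_space_polish : polish R T.
Proof.
split.
  exists setT; first exact/finite_set_countable/(@finite_finset 'I_k.+1).
  by move=> A [x Ax] _; exists x.
exists T, id, id; split => //; [by move=> x; exact: cvg_id..|].
move=> F FF cF.
have FT : F setT by exact: filterT.
have := compact_cauchy_cvg FF cF FT finite_space_compact.
by move=> /cvg_ex.
Qed.

End finite_space.

(** * From closures of orbit laws to weak containment *)

Section weak_containment_converse.
Context (R : realType) (G : groupType) (cG : countable [set: G]).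
Context dX (X : measurableType dX) (mu : probability X R) (a : G -> X -> X)
  (ha : invariant_action mu a).
Context dW (W : measurableType dW) (nu : probability W R) (c : G -> W -> W)
  (hc : invariant_action nu c).

Lemma finite_space_second_countable k : @second_countable (finite_space R k).
Proof. exact: polish_second_countable (finite_space_polish R k). Qed.

Lemma finite_space_power_cts k (g : G) (i j : finite_space R k) :
  continuous (fun p : power G (finite_space R k) => \1_[set p | p g = i /\ p 1%g = j] p : R).
Proof.
move=> p; pose f := \1_[set p | p g = i /\ p 1%g = j] : power G (finite_space R k) -> R.
apply: (@near_cst_continuous _ _ (f p) f p).
have h1 : nbhs p ((fun q : power G (finite_space R k) => q g) @^-1` [set p g]).
  by apply: prod_proj_continuous; apply: open_nbhs_nbhs; split => //; exact: finite_space_open.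
have h2 : nbhs p ((fun q : power G (finite_space R k) => q 1%g) @^-1` [set p 1%g]).
  by apply: prod_proj_continuous; apply: open_nbhs_nbhs; split => //; exact: finite_space_open.
by apply: filterS2 h1 h2 => q /= qg q1; rewrite /f !indicE; congr (nat_of_bool _)%:R;
  apply/idP/idP; rewrite !inE/= qg q1.
Qed.

(** The orbit map at [x] has coordinate [g] equal to [i] exactly when [x] lies in the [g]-translate
    of the [i]-th fibre. The masses compared in weak containment are thus integrals of continuous
    functions. *)
Lemma integral_orbit_pair k d (S : measurableType d) (P : probability S R)
    (t : G -> S -> S) (ht : invariant_action P t) (phi : S -> finite_space R k)
    (mphi : measurable_fun [set: S] (phi : S -> borel (finite_space R k)))
    (g : G) (i j : finite_space R k) :
  \int[P]_x (\1_[set p : power G (finite_space R k) | p g = i /\ p 1%g = j]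
    (orbit_map t phi x) : R) =
  fine (P (t g @` (phi @^-1` [set i]) `&` (phi @^-1` [set j]))).
Proof.
have mi l : measurable (phi @^-1` [set l]).
  rewrite -[_ @^-1` _]setTI; apply: mphi => //; apply: sub_sigma_algebra.
  exact: finite_space_open.
pose A := t g @` (phi @^-1` [set i]) `&` (phi @^-1` [set j]).
rewrite -/A /Rintegral.
have -> : (\int[P]_x (\1_[set p : power G (finite_space R k) | p g = i /\ p 1%g = j]
    (orbit_map t phi x))%:E = \int[P]_x (\1_A x)%:E)%E.
  apply: eq_integral => x _; congr EFin; rewrite !indicE; congr (nat_of_bool _)%:R.
  rewrite /A (image_action _ _ ht).
  apply/idP/idP; rewrite !inE /orbit_map/= invg1 (inv_act1 ht)//.
rewrite integral_indic ?setIT//; apply: measurableI => //.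
exact: (measurable_image_action _ ht).
Qed.

(** A partition into [k.+1] parts is a map to the finite space; a map on [W] whose law is close on
    the pair indicators has the required partition as its fibres. *)
Lemma E_weakly_contained :
  (forall k, E_set (finite_space R k) mu a `<=` closure (E_set (finite_space R k) nu c)) ->
  weakly_contained mu a nu c.
Proof.
move=> HE [|k] A F eps pA fF e0.
  (* A space of mass [1] has no partition into zero parts. *)
  have [_ _ A0] := pA; have := probability_setT mu.
  rewrite -A0 (_ : \bigcup_i A i = set0) ?measure0; last first.
    by apply/seteqP; split => // x [[]].
  by move=> /eqP; rewrite eq_sym onee_eq0.
pose K : ptopologicalType := finite_space R k.
have cK := @finite_space_compact R k; have sK := @finite_space_second_countable k.
have [phi0 phiA] := borel_partition_index pA.
have mA i : measurable (A i) by have [] := pA.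
pose phi : X -> K := phi0.
have mphi : measurable_fun [set: X] (phi : X -> borel K).
  move=> _ U _; rewrite setTI; apply: (measurable_fin_preimage (tau := phi0) U) => i.
  by rewrite phiA.
have [m mE] := orbit_Ms cG sK ha mphi.
have Em : E_set K mu a m by exists phi.
pose ind (t : G * (K * K)) : continuousType (power G K) R :=
  mkcts (@finite_space_power_cts k t.1 t.2.1 t.2.2).
have fD : finite_set (ind @` (F `*` setT)).
  apply/finite_image/finite_setX => //.
  exact: (@finite_finset ('I_k.+1 * 'I_k.+1)%type).
have [m' [psi mpsi m'E] close] := (closure_MsP _ _).1 (HE k m Em) _ _ fD e0.
have mi (l : K) : measurable (psi @^-1` [set l]).
  rewrite -[_ @^-1` _]setTI; apply: mpsi => //; apply: sub_sigma_algebra.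
  exact: finite_space_open.
exists (fun i => psi @^-1` [set (i : K)]).
  exact: (@index_borel_partition _ W k.+1 psi mi).
move=> g i j Fg.
have := close (ind (g, (i : K, j : K))) (ex_intro2 _ _ (g, (i : K, j : K)) (conj Fg I) erefl).
rewrite (expect_orbit cG sK ha mphi cK _ mE) (expect_orbit cG sK hc mpsi cK _ m'E).
rewrite /ind /= (integral_orbit_pair ha mphi) (integral_orbit_pair hc mpsi).
rewrite !phiA lte_dist_fin//; apply: fin_num_measure; apply: measurableI => //.
- exact: (measurable_image_action _ ha (mA i)).
- exact: (measurable_image_action _ hc (mi i)).
Qed.

End weak_containment_converse.

Theorem theorem1p1 (R : realType) (G : groupType) (cG : countable [set: G])
    (dY : measure_display) (Y : measurableType dY) (nu : probability Y R)
    (b : G -> Y -> Y) (hb : mp_action nu b)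
    (dZ : measure_display) (Z : measurableType dZ) (lam : probability Z R)
    (sZ : standard_borel R Z) (naZ : nonatomic lam) :
  (forall K : ptopologicalType, compact [set: K] -> polish R K ->
    closure (E_set K (lam \x nu)%E (diag_action (@trivial_action G Z) b)) =
    closed_convex_hull (E_set K nu b)) /\
  (forall (dX : measure_display) (X : measurableType dX) (mu : probability X R)
      (a : G -> X -> X), mp_action mu a ->
    weakly_contained mu a (lam \x nu)%E (diag_action (@trivial_action G Z) b) <->
    (forall K : ptopologicalType, compact [set: K] -> polish R K ->
      E_set K mu a `<=` closed_convex_hull (E_set K nu b))).
Proof.
have ib := mp_invariant_action hb.
have ic := trivial_diag_invariant lam ib.
have part1 (K : ptopologicalType) : compact [set: K] -> polish R K ->
    closure (E_set K (lam \x nu)%E (diag_action (@trivial_action G Z) b)) =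
    closed_convex_hull (E_set K nu b).
  move=> cK /polish_second_countable sK; apply/seteqP; split.
    (* The closed convex hull equals its own closure, so the inclusion before closure is enough. *)
    rewrite /closed_convex_hull [X in _ `<=` X](closure_id _).1.
      apply: closure_subset; exact: E_sub_closed_convex_hull.
    exact: closed_closure.
  by apply: closure_subset; exact: convex_hull_sub_E.
split=> // dX X mu a /mp_invariant_action ia; split => [wac K cK pK|HE].
  rewrite -part1//; apply: weakly_contained_E => //.
  exact: polish_second_countable pK.
apply: E_weakly_contained => // k; rewrite part1.
- exact: HE (@finite_space_compact R k) (finite_space_polish R k).
- exact: finite_space_compact.
- exact: finite_space_polish.
Qed.
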